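(* Let $n\geq 1$ and let $i,j\geq 0$ be integers. Let $F_{n,i,j}$ denote the set of functions $f\colon[n+1]\to[n]$ such that the orbit of $n+1$ under $f$ has exactly $i$ elements and $f$ has exactly $j$ periodic points. Then \[ |F_{n,i+1,j}|=\sum_{s=0}^{\min(i,j)-1}\frac{(i+j-s-1)\, n!}{(n-i-j+s+1)!}\,n^{\,n-i-j+s}, \] with the convention that $1/m!=0$ for negative integers $m$ (and an empty sum equals $0$).
   Context: $[m]=\{1,\dots,m\}$. For $f\colon[n+1]\to[n]$, the orbit of $x$ is the set $\{x,f(x),f^2(x),\dots\}$ (iterating $f$, which makes sense since $[n]\subseteq[n+1]$), and $x$ is a periodic point of $f$ if $f^k(x)=x$ for some $k\geq 1$. *)

(* Defs.v *)
From HB Require Import structures.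
From mathcomp Require Import all_boot all_order all_algebra.
From mathcomp Require Import boolp.
Set Implicit Arguments. Unset Strict Implicit. Unset Printing Implicit Defensive.
Import Order.TTheory GRing.Theory Num.Theory.

(* [m] = {1..m} is encoded as 'I_m, element k : 'I_m standing for k+1.
   So n+1 (the largest element of [n+1]) is ord_max : 'I_n.+1. *)

Definition step n (f : {ffun 'I_n.+1 -> 'I_n}) (x : 'I_n.+1) : 'I_n.+1 :=
  widen_ord (leqnSn n) (f x).

Definition orbit_top n (f : {ffun 'I_n.+1 -> 'I_n}) : {set 'I_n.+1} :=
  [set y | `[< exists k : nat, iter k (step f) ord_max = y >]].

Definition periodic_pts n (f : {ffun 'I_n.+1 -> 'I_n}) : {set 'I_n.+1} :=
  [set x | `[< exists k : nat, (1 <= k)%N /\ iter k (step f) x = x >]].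

Definition Fset n i j : {set {ffun 'I_n.+1 -> 'I_n}} :=
  [set f | (#|orbit_top f| == i) && (#|periodic_pts f| == j)].

Local Open Scope ring_scope.

Definition invfact (m : int) : rat :=
  if m < 0 then 0 else ((`|m|%N)`!)%:R^-1.

(* Main.v *)
(** Deleting the point n+1 turns f into a map h on [n] together with a starting
    point x = f(n+1); the orbit of x under h is a "lasso": an injective sequence
    x_0, ..., x_(i-1) whose last point is sent back to some x_k, so that exactly
    i - k of its points are periodic.  Replacing h by the identity on the lasso
    changes the number of periodic points by k only, so everything reduces to
    counting the maps that are the identity on a given set S and have q periodic
    points.  Given the set P of periodic points, such a map is a permutation of
    P \ S and a forest rooted at P.  The number B(P) of forests satisfies
    n B(P) = |P| n^(n-|P|): classifying all the n^(n-|S|) maps that are the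
    identity on S by their periodic set gives a recurrence for B, which this
    formula solves because the resulting sum telescopes. *)
Require Import Defs.
From HB Require Import structures.
From mathcomp Require Import all_boot all_order all_algebra.
From mathcomp Require Import perm zify ring.
From mathcomp Require boolp.
Set Implicit Arguments. Unset Strict Implicit. Unset Printing Implicit Defensive.
Import Order.TTheory GRing.Theory Num.Theory.

(** * Periodic points of maps that agree on or off a closed subset *)

Definition periodic (T : finType) (f : T -> T) : {set T} := [set x | x \in fconnect f (f x)].

Lemma periodicP (T : finType) (f : T -> T) x :
  reflect (exists k, iter k.+1 f x = x) (x \in periodic f).
Proof.
by rewrite inE; apply: (iffP idP) => /(orbitPcycle 2 3).
Qed.

Lemma iter_stable (T : finType) (S : {set T}) (f : T -> T) k x :
  {in S, forall y, f y \in S} -> x \in S -> iter k f x \in S.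
Proof. by move=> fS xS; elim: k => //= k; apply: fS. Qed.

(** A cycle of [f] through a point outside [S] never meets [S], since an orbit cannot leave [S]
    again; hence [g] agrees with [f] along the whole cycle. *)
Lemma periodic_outside_sub (T : finType) (S : {set T}) (f g : T -> T) :
    {in S, forall y, f y \in S} -> {in ~: S, f =1 g} ->
  periodic f :\: S \subset periodic g :\: S.
Proof.
move=> fS fg; apply/subsetP => x; rewrite !in_setD => /andP[xS /periodicP[k kx]].
rewrite xS /=; apply/periodicP; exists k.
suff H m : m <= k.+1 -> iter m g x = iter m f x by rewrite H.
elim: m => //= m IH le_mk; rewrite IH ?(ltnW le_mk) // fg // inE.
apply: contra xS => iS; rewrite -kx -(subnK (ltnW le_mk)) iterD.
exact: iter_stable.
Qed.

Lemma periodic_outside (T : finType) (S : {set T}) (f g : T -> T) :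
    {in S, forall y, f y \in S} -> {in S, forall y, g y \in S} ->
  {in ~: S, f =1 g} -> periodic f :\: S = periodic g :\: S.
Proof.
move=> fS gS fg; apply/eqP; rewrite eqEsubset !periodic_outside_sub //.
by move=> x xS; rewrite fg.
Qed.

Lemma periodic_inside (T : finType) (S : {set T}) (f g : T -> T) :
    {in S, forall y, f y \in S} -> {in S, f =1 g} -> periodic f :&: S = periodic g :&: S.
Proof.
move=> fS fg; apply/setP => x; rewrite !in_setI.
case xS: (x \in S); last by rewrite !andbF.
have H m : iter m g x = iter m f x.
  by elim: m => //= m ->; rewrite fg // iter_stable.
by congr (_ && _); apply/periodicP/periodicP => -[k]; rewrite ?H => kx; exists k; rewrite ?H.
Qed.

Lemma imset_periodic (T : finType) (f : T -> T) : f @: periodic f = periodic f.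
Proof.
apply/setP => x; apply/imsetP/periodicP => [[y /periodicP[k ky] ->] | [k kx]].
  by exists k; rewrite -iterSr iterS ky.
exists (iter k f x); last by rewrite -iterS kx.
by apply/periodicP; exists k; rewrite -iterD addnC iterD kx.
Qed.

(** * Maps with prescribed values on a subset *)

Definition extensions (T : finType) (S : {set T}) (f : T -> T) : {set {ffun T -> T}} :=
  [set h : {ffun T -> T} | [forall x in S, h x == f x]].

Lemma extensionsP (T : finType) (S : {set T}) (f : T -> T) (h : {ffun T -> T}) :
  reflect {in S, h =1 f} (h \in extensions S f).
Proof.
rewrite inE; apply: (iffP forall_inP) => H x xS; first exact/eqP/H.
by rewrite H.
Qed.

Definition override (T : finType) (S : {set T}) (f g : T -> T) : {ffun T -> T} :=
  [ffun x => if x \in S then f x else g x].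

Lemma override_in (T : finType) (S : {set T}) (f g : T -> T) :
  override S f g \in extensions S f.
Proof. by apply/extensionsP => x xS; rewrite ffunE xS. Qed.

(** Off [S] the periodic points of [g] and [h] coincide; on [S], every point is periodic for [g],
    while [h] has those of [f]. The additive form avoids truncated subtraction. *)
Lemma card_periodic_agree (T : finType) (S : {set T}) (f g h : T -> T) :
    {in S, forall y, f y \in S} -> {in S, h =1 f} -> {in S, g =1 id} ->
    {in ~: S, h =1 g} ->
  #|periodic g| + #|periodic f :&: S| = #|periodic h| + #|S|.
Proof.
move=> fS hf gS hg.
have hS : {in S, forall y, h y \in S} by move=> y yS; rewrite hf ?fS.
have gS' : {in S, forall y, g y \in S} by move=> y yS; rewrite gS.
rewrite -(cardsID S (periodic g)) -(cardsID S (periodic h)).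
rewrite (periodic_outside hS gS' hg) (periodic_inside hS hf).
suff -> : periodic g :&: S = S by lia.
apply/setIidPr/subsetP => x xS; apply/periodicP; exists 0.
exact: gS.
Qed.

Lemma card_extensions (T : finType) (S : {set T}) (f : T -> T) :
  #|extensions S f| = #|T| ^ #|~: S|.
Proof.
pose F x : pred T := if x \in S then pred1 (f x) else predT.
transitivity #|(family F : {pred {ffun T -> T}})|.
  apply: eq_card => h; apply/extensionsP/familyP => H x.
    by rewrite /F; case: ifP => // xS; rewrite inE H.
  by move=> xS; have := H x; rewrite /F xS inE => /eqP.
rewrite card_family foldrE big_map big_enum /= (bigID (mem S)) /=.
rewrite big1 ?mul1n => [|x xS]; last by rewrite /F xS card1.
rewrite (eq_bigr (fun=> #|T|)) => [|x /negPf xS]; last by rewrite /F xS.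
by rewrite big_const -Monoid.iteropE; congr (_ ^ _); apply: eq_card => x; rewrite !inE.
Qed.

(** Overwriting the values on [S] by those of [f] and overwriting them by the identity are mutually
    inverse. *)
Lemma card_extensions_periodic (T : finType) (S : {set T}) (f : T -> T) j :
    {in S, forall y, f y \in S} ->
  #|[set h in extensions S f | #|periodic h| == j]| =
  #|[set g in extensions S id | #|periodic g| + #|periodic f :&: S| == j + #|S|]|.
Proof.
move=> fS.
have inj : {in [set g in extensions S id | #|periodic g| + #|periodic f :&: S| == j + #|S|] &,
  injective (fun g : {ffun T -> T} => override S f g)}.
  move=> g1 g2 /setIdP[/extensionsP g1S _] /setIdP[/extensionsP g2S _].
  move=> /ffunP e; apply/ffunP => x; have := e x; rewrite !ffunE.
  by case: ifP => // xS _; rewrite g1S ?g2S.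
rewrite -(card_in_imset inj); apply: eq_card => h.
apply/setIdP/imsetP => [[/extensionsP hf /eqP hj] | [g /setIdP[/extensionsP gS /eqP gj] ->]].
  exists (override S id h).
    apply/setIdP; split; first exact: override_in.
    rewrite -hj; apply/eqP/card_periodic_agree => // x; rewrite ?inE => xS; rewrite ffunE ?xS //.
    by rewrite (negPf xS).
  by apply/ffunP => x; rewrite !ffunE; case: (boolP (x \in S)) => // xS; rewrite hf.
split; first exact: override_in.
rewrite -(eqn_add2r #|S|) -gj eq_sym; apply/eqP/card_periodic_agree => // x;
  rewrite ?inE => xS; rewrite ffunE ?xS //.
by rewrite (negPf xS).
Qed.

(** * Forests with a given root set *)

(* With roots encoded as fixed points, these are the forests on [T] with root set [R]. *)
Definition rooted (T : finType) (R : {set T}) : {set {ffun T -> T}} :=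
  [set g in extensions R id | periodic g == R].

(** A map permutes its periodic set [P], so it splits uniquely into a permutation of [P] fixing [R]
    and a forest rooted at [P]; [override] glues the two. *)
Lemma card_periodic_eq (T : finType) (R P : {set T}) : R \subset P ->
  #|[set h in extensions R id | periodic h == P]| = (#|P :\: R|)`! * #|rooted P|.
Proof.
move=> RP.
pose A : {set {perm T}} := [set s | perm_on (P :\: R) s].
have -> : (#|P :\: R|)`! = #|A| by rewrite -card_perm; apply: eq_card => s; rewrite inE.
rewrite -cardsX.
pose phi (p : {perm T} * {ffun T -> T}) := override P p.1 p.2.
have inj : {in setX A (rooted P) &, injective phi}.
  move=> [s1 g1] [s2 g2] /setXP[/= s1A /setIdP[/extensionsP g1P _]].
  move=> /setXP[/= s2A /setIdP[/extensionsP g2P _]].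
  move=> /ffunP e; congr (_, _).
    apply/permP => x; have := e x; rewrite !ffunE /=; case: ifP => // xP _.
    by rewrite !in_set in s1A s2A; rewrite (out_perm s1A) ?(out_perm s2A) // inE xP andbF.
  apply/ffunP => x; have := e x; rewrite !ffunE /=; case: ifP => // xS _.
  by rewrite g1P ?g2P.
rewrite -(card_in_imset inj); apply: eq_card => h.
apply/setIdP/imsetP => [[/extensionsP hR /eqP hP] | ].
  have hPP : h @: P = P by rewrite -hP imset_periodic.
  have hI : {in P &, injective h} by apply/imset_injP; rewrite hPP.
  pose sf x := if x \in P then h x else x.
  have sI : injective sf.
    have hx x : x \in P -> h x \in P by move=> xP; rewrite -hPP imset_f.
    move=> x y; rewrite /sf; case: ifP => xP; case: ifP => yP //; first exact: hI.
      by move=> e; rewrite -e hx in yP.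
    by move=> e; rewrite e hx in xP.
  exists (perm sI, override P id h).
    apply/setXP; split=> /=.
      rewrite inE; apply/subsetP => x; rewrite inE permE /sf in_setD.
      case: ifP => [xP hxx | _]; last by rewrite eqxx.
      by rewrite andbT; apply: contra hxx => xR; rewrite hR.
    apply/setIdP; split; first exact: override_in.
    rewrite eqEsubset; apply/andP; split; last first.
      by apply/subsetP => x xP; apply/periodicP; exists 0; rewrite /= ffunE xP.
    rewrite -setD_eq0 -(@periodic_outside _ P h).
    - by rewrite hP setDv.
    - by move=> x xP; rewrite -[in _ \in _]hPP imset_f.
    - by move=> x xP; rewrite ffunE xP.
    - by move=> x; rewrite inE ffunE => /negPf->.
  by apply/ffunP => x; rewrite !ffunE /= permE /sf; case: ifP => xP; rewrite ?xP.
move=> [[s g] /setXP[/= sA /setIdP[/extensionsP gP /eqP pg]] ->].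
rewrite in_set in sA.
have phiP x : x \in P -> phi (s, g) x = s x by rewrite ffunE => ->.
have phiN x : x \in ~: P -> phi (s, g) x = g x by rewrite ffunE inE => /negPf->.
have sP x : x \in P -> s x \in P.
  move=> xP; case: (boolP (x \in R)) => xR; first by rewrite (out_perm sA) // inE xR.
  have := perm_closed x sA; rewrite !in_setD xP xR => /andP[] //.
split.
  apply/extensionsP => x xR; rewrite phiP ?(out_perm sA) ?inE ?xR //.
  exact: (subsetP RP).
rewrite eqEsubset; apply/andP; split.
  rewrite -setD_eq0 (@periodic_outside _ P _ g) //.
  - by rewrite pg setDv.
  - by move=> x xP; rewrite phiP ?sP.
  - by move=> x xP; rewrite gP.
apply/subsetP => x xP.
suff: x \in periodic (phi (s, g)) :&: P by rewrite in_setI => /andP[].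
rewrite -(@periodic_inside _ P s) //; last by move=> y yP; rewrite phiP.
(* A map that is injective on an orbit turns that orbit into a cycle, so all points are periodic
   under [s]. *)
rewrite in_setI xP andbT inE; apply/(orbitPcycle 5 2) => ? ? _ _; exact: perm_inj.
Qed.


(** Write [P] as [R :|: Q] with [Q] disjoint from [R], and group by the size of [Q]. *)
Lemma sum_supersets (T : finType) (R : {set T}) (F : nat -> nat) :
  \sum_(P : {set T} | R \subset P) F #|P| =
  \sum_(0 <= k < #|~: R|.+1) 'C(#|~: R|, k) * F (#|R| + k).
Proof.
rewrite (reindex_onto (fun Q => R :|: Q) (fun P => P :\: R)) /=; last first.
  by move=> P RP; rewrite setDE setUIr setUCr setIT; apply/setUidPr.
rewrite (eq_bigl (fun Q : {set T} => Q \subset ~: R)) => [|Q]; last first.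
  rewrite subsetUl /= setDUl setDv set0U -disjoints_subset.
  exact: (sameP eqP setDidPl).
rewrite big_mkord.
rewrite (partition_big (fun Q : {set T} => inord #|Q| : 'I_#|~: R|.+1) xpredT) //=.
apply: eq_bigr => k _.
rewrite -[X in _ = X * _]cards_draws -[X in _ = X * _]sum1_card big_distrl /=.
apply: congr_big => // Q.
  rewrite inE; case QR: (Q \subset ~: R) => //=.
  by rewrite -val_eqE /= inordK // ltnS subset_leq_card.
case/andP=> QR /eqP <-; rewrite mul1n cardsU inordK ?ltnS ?subset_leq_card //.
have /eqP -> : R :&: Q == set0 by rewrite setI_eq0 disjoint_sym disjoints_subset.
by rewrite cards0 subn0.
Qed.

(** Since [r + k] is [(r + m) - (m - k)], each term is a difference of consecutive values of
    [m ^_ k * (r + m) ^ (m.+1 - k)], so the sum telescopes. *)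
Lemma sum_ffact_expn m r :
  \sum_(0 <= k < m.+1) m ^_ k * (r + k) * (r + m) ^ (m - k) = (r + m) ^ m.+1.
Proof.
(* The partial sum plus its remainder is constant in [K]; at [K = m.+1] the remainder vanishes
   because [m ^_ m.+1 = 0]. *)
suff H K : K <= m.+1 -> \sum_(0 <= k < K) m ^_ k * (r + k) * (r + m) ^ (m - k)
    + m ^_ K * (r + m) ^ (m.+1 - K) = (r + m) ^ m.+1.
  by rewrite -[RHS](H _ (leqnn _)) ffact_small // addn0.
elim: K => [_ | K IH le_K]; first by rewrite big_geq // ffactn0 subn0 mul1n.
rewrite -IH ?(ltnW le_K) // big_nat_recr //= -addnA subSS; congr addn.
rewrite ffactnSr subSn // expnS.
move: (_ ^ _) (_ ^_ _) => a b; have -> : r + m = r + K + (m - K) by lia.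
by rewrite -mulnA -mulnA -mulnDr mulnA -mulnDl mulnA. 
Qed.

(** Induction on the size of the complement of [R]. The factor [#|T|] on the left avoids the
    exponent -1 when [R] is everything. *)
Lemma card_rooted (T : finType) (R : {set T}) :
  #|rooted R| * #|T| = #|R| * #|T| ^ #|~: R|.
Proof.
have [m le_m] := ubnP #|~: R|; elim: m R le_m => // m IH R; rewrite ltnS => le_m.
(* The predicted contribution of a periodic set of size [p], times [#|T|]. Predicted and true totals
   both equal [#|T| ^ #|~: R|.+1]; by induction they agree termwise for [P] larger than [R], hence
   also at [P = R]. *)
pose F p := (p - #|R|)`! * p * #|T| ^ (#|T| - p).
have cR : #|R| + #|~: R| = #|T| by rewrite cardsC.
have : \sum_(P : {set T} | R \subset P) F #|P| =
       \sum_(P : {set T} | R \subset P) (#|P :\: R|)`! * #|rooted P| * #|T|.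
  rewrite sum_supersets -big_distrl /=.
  transitivity (#|T| ^ #|~: R|.+1).
    rewrite -cR -sum_ffact_expn; apply: eq_big_nat => k /andP[_ le_k].
    by rewrite /F !mulnA -cR addKn bin_ffact subnDl.
  rewrite expnSr -(card_extensions R id) -sum1_card; congr (_ * _).
  rewrite (partition_big (fun h : {ffun T -> T} => periodic h) (fun P => R \subset P)) /=.
    apply: eq_bigr => P RP; rewrite -card_periodic_eq // -sum1_card; apply: eq_bigl => h.
    by rewrite [in RHS]inE.
  move=> h /extensionsP hR; apply/subsetP => x xR; apply/periodicP; exists 0; exact: hR.
have FP (P : {set T}) : R \proper P -> (#|P :\: R|)`! * #|rooted P| * #|T| = F #|P|.
  move=> RP; rewrite -mulnA IH; last first.
    by apply: leq_trans le_m; apply: proper_card; rewrite properC.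
  by rewrite /F cardsDS ?proper_sub // mulnA -(cardsC P) addKn.
rewrite (bigD1 R) //= [RHS](bigD1 R) //= => /eqP.
rewrite [X in _ == _ + X](eq_bigr (fun P : {set T} => F #|P|)) => [|P]; last first.
  by rewrite eq_sym eqEproper => /andP[RP]; rewrite RP /=; rewrite negbK; apply: FP.
rewrite eqn_add2r setDv cards0 fact0 mul1n => /eqP <-.
by rewrite /F subnn fact0 mul1n -cR addKn.
Qed.

(** Choosing a periodic set of size [q] above [S] and permuting its points outside [S] gives a
    binomial times a factorial, which is the falling factorial; [card_rooted] counts the forests. *)
Lemma card_identity_on (T : finType) (S : {set T}) q : #|S| <= q ->
  #|[set g in extensions S id | #|periodic g| == q]| * #|T| =
  (#|T| - #|S|) ^_ (q - #|S|) * q * #|T| ^ (#|T| - q).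
Proof.
move=> Sq.
pose F p := if p == q then (p - #|S|)`! * q * #|T| ^ (#|T| - q) else 0.
transitivity (\sum_(P : {set T} | S \subset P) F #|P|).
  rewrite -sum1_card (partition_big (fun h : {ffun T -> T} => periodic h)
    (fun P => S \subset P)) /=.
    rewrite big_distrl /=; apply: eq_bigr => P SP; rewrite /F.
    case: eqP => Pq.
      rewrite -Pq -cardsDS // -mulnA -(cardsC P) addKn cardsC.
      rewrite -card_rooted mulnA -card_periodic_eq //.
      congr (_ * _); rewrite -[RHS]sum1_card; apply: eq_bigl => h.
      by rewrite !in_set; case: (periodic h =P P) => [->|_]; rewrite ?Pq ?eqxx ?andbT ?andbF.
    rewrite big1 // => h /andP[]; rewrite in_set => /andP[_ /eqP hq] /eqP hP.
    by rewrite -hP in Pq.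
  move=> h /setIdP[/extensionsP hS _]; apply/subsetP => x xS; apply/periodicP; exists 0; exact: hS.
have cS := cardsC S.
rewrite sum_supersets /F; have -> : #|T| - #|S| = #|~: S| by lia.
(* If [q] exceeds [#|T|], no set of size [q] occurs and the falling factorial is 0. *)
case: (leqP (q - #|S|) #|~: S|) => le_q; last first.
  rewrite ffact_small // mul0n; apply: big1_seq => k.
  rewrite mem_index_iota => /andP[_ /andP[_ lek]].
  by case: eqP; rewrite ?muln0 //; lia.
rewrite (bigD1_seq (q - #|S|)) ?mem_index_iota ?iota_uniq //= subnKC // eqxx.
rewrite big1 ?addn0 => [|k kq]; first by rewrite !mulnA bin_ffact.
by case: eqP; rewrite ?muln0 //; lia.
Qed.

(** * Lassos: orbits that run into a cycle *)

(* Sends each entry of [s] to the next one, and the last entry back to entry [k]. *)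
Definition lasso (T : eqType) (s : seq T) (k : nat) (y : T) : T :=
  nth y s (if (index y s).+1 < size s then (index y s).+1 else k).

Lemma lasso_nth (T : eqType) (s : seq T) k x0 a : uniq s -> k < size s -> a < size s ->
  lasso s k (nth x0 s a) = nth x0 s (if a.+1 < size s then a.+1 else k).
Proof.
move=> Us ks a_s; rewrite /lasso index_uniq //; apply: set_nth_default.
by case: ifP.
Qed.

Lemma lasso_mem (T : eqType) (s : seq T) k y : k < size s -> lasso s k y \in s.
Proof. by move=> ks; rewrite mem_nth //; case: ifP. Qed.

(** The entries from index [k] on form the cycle; those before [k] are never revisited. *)
Lemma card_periodic_lasso (T : finType) (s : seq T) k : uniq s -> k < size s ->
  #|periodic (lasso s k) :&: [set y in s]| = size s - k.
Proof.
move=> Us ks.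
have [x0 _] : exists x0 : T, true by case: s ks {Us} => // x; exists x.
pose next a := if a.+1 < size s then a.+1 else k.
have next_lt a : next a < size s by rewrite /next; case: ifP.
have iter_lt m a : a < size s -> iter m next a < size s by case: m => //= m _.
have iterE m a : a < size s -> iter m (lasso s k) (nth x0 s a) = nth x0 s (iter m next a).
  by move=> a_s; elim: m => //= m ->; rewrite lasso_nth ?iter_lt.
have iter_add m a : a + m < size s -> iter m next a = a + m.
  elim: m => [|m IH] lt_m /=; rewrite ?addn0 // IH 1?/next; last by lia.
  by rewrite addnS in lt_m *; rewrite lt_m.
suff -> : periodic (lasso s k) :&: [set y in s] = [set y in drop k s].
  by rewrite cardsE (card_uniqP (drop_uniq k Us)) size_drop.
apply/setP => y; rewrite in_setI [y \in [set _ in s]]in_set [RHS]in_set.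
case: (boolP (y \in s)) => ys; last first.
  by rewrite andbF; apply/esym/negbTE; apply: contra ys; apply: mem_drop.
have -> : (y \in drop k s) = (k <= index y s).
  have := Us; rewrite -{1}(cat_take_drop k s) cat_uniq => /and3P[_ /hasPn dis _].
  rewrite leqNgt -(in_take _ ys); move: ys; rewrite -{1}(cat_take_drop k s) mem_cat.
  by case: (boolP (y \in drop k s)) => [/dis ->|_]; rewrite ?orbF // => ->.
have as_ : index y s < size s by rewrite index_mem.
have yE := nth_index x0 ys; set a := index y s in as_ yE *.
rewrite andbT -yE; apply/idP/idP.
  case/periodicP => m; rewrite iterE // => /eqP; rewrite nth_uniq ?iter_lt // => /eqP e.
  rewrite leqNgt; apply/negP => lt_ak; suff: a < iter m.+1 next a by rewrite e ltnn.
  (* Here [a < k]: the index either grows by one or jumps back to [k], so it stays above [a] after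
     the first step. *)
  have next_gt b : a <= b -> a < next b by rewrite /next; case: ifP; lia.
  by elim: m {e} => [|m IH]; rewrite iterS; apply: next_gt => //; apply: ltnW.
move=> le_ka; apply/periodicP; exists (size s - k).-1.
(* Once around the cycle: from [a] to the last index, one step to [k], then [a - k] steps back to
   [a]. *)
have -> : (size s - k).-1.+1 = (a - k) + (1 + ((size s).-1 - a)) by lia.
rewrite iterE // !iterD [iter _ next a]iter_add; last by lia.
have -> : iter 1 next (a + ((size s).-1 - a)) = k.
  by rewrite /= /next; case: ifP => //; lia.
by rewrite iter_add; [congr nth|]; lia.
Qed.

Lemma nth_traject_default (T : Type) (f : T -> T) x0 x n a :
  a < n -> nth x0 (traject f x n) a = iter a f x.
Proof.
by move=> lt_a; rewrite (set_nth_default x) ?size_traject // nth_traject.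
Qed.

Lemma lasso_extension (T : finType) (h : {ffun T -> T}) (x : T) (s : seq T) k :
    uniq s -> k < size s ->
  h \in extensions [set y in s] (lasso s k) =
  (s == traject h (head x s) (size s)) && (iter (size s) h (head x s) == nth x s k).
Proof.
move=> Us ks.
have lt0s : 0 < size s by lia.
apply/extensionsP/andP => [hs | [/eqP st /eqP hk] y]; last first.
  rewrite inE => ys; rewrite -(nth_index x ys).
  have := ys; rewrite -index_mem; move: (index y s) => a lt_a.
  rewrite lasso_nth // [in LHS]st nth_traject_default // -iterS.
  case: ltnP => [lt_a1 | le_sa]; first by rewrite [in RHS]st nth_traject_default.
  by rewrite (_ : a.+1 = size s) //; apply/eqP; rewrite eqn_leq lt_a le_sa.
have hs' a : a < size s -> h (nth x s a) = nth x s (if a.+1 < size s then a.+1 else k).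
  by move=> lt_a; rewrite hs ?inE ?mem_nth // lasso_nth.
have E a : a < size s -> nth x s a = iter a h (head x s).
  elim: a => [_|a IH lt_a]; first by rewrite nth0.
  by rewrite iterS -IH ?(ltnW lt_a) // hs' ?(ltnW lt_a) // lt_a.
split; apply/eqP.
  apply: (@eq_from_nth _ x) => [|a lt_a]; first by rewrite size_traject.
  by rewrite nth_traject_default // E.
rewrite -(prednK lt0s) iterS -E ?prednK // hs' ?prednK //.
by rewrite ltnn.
Qed.

(** A starting point determines its lasso, namely its orbit listed in order and the index to which
    the orbit returns; conversely the point is the head of the lasso. *)
Lemma card_order (T : finType) (h : {ffun T -> T}) i :
  #|[set x | fingraph.order h x == i]| =
  #|[set p : i.-tuple T * 'I_i |
      uniq p.1 & h \in extensions [set y in p.1] (lasso p.1 p.2)]|.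
Proof.
have [x0 _ | T0] := pickP T; last first.
  by rewrite !eq_card0 // => [[t k]|x]; [have := T0 (tnth t k) | have := T0 x].
pose A := [set p : i.-tuple T * 'I_i |
      uniq p.1 & h \in extensions [set y in p.1] (lasso p.1 p.2)].
have AP p : p \in A -> [/\ uniq p.1, val p.1 = traject h (head x0 p.1) i
    & iter i h (head x0 p.1) = nth x0 p.1 p.2].
  case/setIdP=> Up; rewrite (lasso_extension h x0) // ?size_tuple //.
  by case/andP=> /eqP e1 /eqP e2.
have inj : {in A &, injective (fun p : i.-tuple T * 'I_i => head x0 p.1)}.
  move=> [t1 k1] [t2 k2] /AP[/= U1 E1 K1] /AP[/= U2 E2 K2] e.
  have et : t1 = t2 by apply: val_inj; rewrite /= E1 E2 e.
  rewrite et in K1 *; congr (_, _); apply/val_inj/eqP.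
  have /eqP := etrans (esym K1) K2.
  by rewrite (nth_uniq x0 _ _ U2) ?size_tuple.
rewrite -(card_in_imset inj); apply: eq_card => x; rewrite inE.
apply/eqP/imsetP => [ox | [p /AP[Up Ep Kp] ->]].
  have /trajectP[k lt_k ek] : iter i h x \in traject h x i.
    by have := looping_order h x; rewrite ox.
  have szt : size (fingraph.orbit h x) == i by rewrite size_orbit ox.
  have hx : head x0 (fingraph.orbit h x) = x.
    by rewrite /fingraph.orbit -orderSpred.
  exists (Tuple szt, Ordinal lt_k); last by rewrite /= hx.
  rewrite inE /= orbit_uniq (lasso_extension h x0) ?orbit_uniq ?(eqP szt) // hx.
  have ot : fingraph.orbit h x = traject h x i by rewrite /fingraph.orbit ox.
  by rewrite /= ot ek nth_traject_default ?eqxx.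
set z := head x0 p.1 in Ep Kp *.
rewrite -[RHS](size_tuple p.1) -(card_uniqP Up); apply: eq_card => y.
rewrite Ep; apply/idP/trajectP => [/iter_findex <- | [a _ ->]]; last exact: fconnect_iter.
(* The trajectory is closed under [h], because its last point is sent to entry [p.2]. *)
elim: (findex _ _ _) => [|m IHm].
  by exists 0; rewrite // (leq_ltn_trans _ (ltn_ord p.2)).
have [a lt_a ea] := IHm; rewrite iterS ea -iterS.
case: (ltnP a.+1 i) => [lt_a1 | le_ia]; first by exists a.+1.
have -> : a.+1 = i by apply/eqP; rewrite eqn_leq lt_a le_ia.
by apply/trajectP; rewrite Kp -Ep mem_nth ?size_tuple.
Qed.

(** * Counting maps with a starting point *)

Lemma ffactD n a b : n ^_ (a + b) = n ^_ a * (n - a) ^_ b.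
Proof.
elim: b => [|b IH]; first by rewrite addn0 ffactn0 muln1.
by rewrite addnS !ffactnSr IH mulnA subnDA.
Qed.

(** Sum over lassos first, then over the maps extending them. A lasso closing at index [k] has
    [i - k] periodic points, so making it the identity raises [j] to [j + k]. *)
Lemma card_pointed_maps (T : finType) i j :
  #|[set p : {ffun T -> T} * T | fingraph.order p.1 p.2 == i & #|periodic p.1| == j]| * #|T| =
  \sum_(k < i | i <= j + k) #|T| ^_ (j + k) * (j + k) * #|T| ^ (#|T| - (j + k)).
Proof.
transitivity ((\sum_(p : i.-tuple T * 'I_i | uniq p.1)
   #|[set h in extensions [set y in p.1] (lasso p.1 p.2) | #|periodic h| == j]|) * #|T|).
  congr (_ * _).
  transitivity (\sum_(h : {ffun T -> T} | #|periodic h| == j) #|[set x | fingraph.order h x == i]|).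
    rewrite -sum1_card (eq_bigl (fun p : {ffun T -> T} * T =>
       (#|periodic p.1| == j) && (fingraph.order p.1 p.2 == i))); last first.
      by move=> p; rewrite inE andbC.
    rewrite -(pair_big_dep (fun h : {ffun T -> T} => #|periodic h| == j)
       (fun (h : {ffun T -> T}) x => fingraph.order h x == i) (fun _ _ => 1)) /=.
    apply: eq_bigr => h _; rewrite -sum1_card; apply: eq_bigl => x.
    by rewrite inE.
  under eq_bigr => h _ do rewrite card_order -sum1_card.
  rewrite (exchange_big_dep (fun p : i.-tuple T * 'I_i => uniq p.1)) /=; last first.
    by move=> h p _ /setIdP[].
  apply: eq_bigr => p Up; rewrite -sum1_card; apply: eq_bigl => h.
  by rewrite [in LHS]inE Up [in RHS]inE andbC.
rewrite (eq_bigl (fun p : i.-tuple T * 'I_i => uniq p.1 && true)) => [|p]; last by rewrite andbT.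
rewrite -(pair_big_dep (fun t : i.-tuple T => uniq t) (fun _ _ => true)
  (fun (t : i.-tuple T) (k : 'I_i) =>
     #|[set h in extensions [set y in t] (lasso t k) | #|periodic h| == j]|)) /=.
rewrite exchange_big /= big_distrl /= [RHS]big_mkcond /=.
apply: eq_bigr => k _.
(* The count for one lasso, depending on [k] alone. It is 0 unless [i <= j + k], as all [i] lasso
   points become fixed. *)
pose D := if i <= j + k then
  (#|T| - i) ^_ (j + k - i) * (j + k) * #|T| ^ (#|T| - (j + k)) else 0.
rewrite big_distrl /= (eq_bigr (fun=> D)) => [|t Ut].
  rewrite sum_nat_const /D (_ : #|_| = #|T| ^_ i); last first.
    rewrite -(card_uniq_tuples i T); apply: eq_card => t; rewrite [RHS]inE.
    by rewrite (_ : all _ _) //; apply/allP.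
  case: ifP => // le_i; last by rewrite muln0.
  by rewrite !mulnA -ffactD subnKC.
have kt : k < size t by rewrite size_tuple.
have ct : #|[set y in t]| = i by rewrite cardsE (card_uniqP Ut) size_tuple.
rewrite card_extensions_periodic; last by move=> y _; rewrite inE lasso_mem.
rewrite card_periodic_lasso // ct size_tuple.
have lt_k := ltn_ord k.
rewrite (_ : [set g in _ | _] =
  [set g in extensions [set y in t] id | #|periodic g| == j + k]); last first.
  by apply/setP => g; rewrite !in_set; congr (_ && _); apply/eqP/eqP; lia.
rewrite /D; case: leqP => [le_i | lt_i]; first by rewrite card_identity_on ct.
rewrite eq_card0 // => g; apply/setIdP => -[/extensionsP gt /eqP pg].
have /subset_leq_card : [set y in t] \subset periodic g.
  by apply/subsetP => y yt; apply/periodicP; exists 0; apply: gt.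
by rewrite ct pg leqNgt lt_i.
Qed.

(** * Deleting the point n+1, and the final formula *)

Lemma card_Fset n i j :
  #|Fset n i.+1 j| =
  #|[set p : {ffun 'I_n -> 'I_n} * 'I_n | fingraph.order p.1 p.2 == i & #|periodic p.1| == j]|.
Proof.
pose w : 'I_n -> 'I_n.+1 := widen_ord (leqnSn n).
have w_inj : injective w by move=> x y /(congr1 val) /= /val_inj.
have w_max x : ord_max != w x by rewrite neq_ltn /= ltn_ord orbT.
have w_lift x : w x = lift ord_max x by apply: val_inj; rewrite /= /bump leqNgt ltn_ord.
pose phi (f : {ffun 'I_n.+1 -> 'I_n}) : {ffun 'I_n -> 'I_n} * 'I_n :=
  ([ffun y => f (w y)], f ord_max).
pose psi (p : {ffun 'I_n -> 'I_n} * 'I_n) : {ffun 'I_n.+1 -> 'I_n} :=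
  [ffun z => oapp p.1 p.2 (unlift ord_max z)].
have phiK : cancel phi psi.
  move=> f; apply/ffunP => z; rewrite ffunE /=.
  by case: unliftP => [y ->|-> //] /=; rewrite ffunE w_lift.
have psiK : cancel psi phi.
  move=> [h x]; congr (_, _); last by rewrite ffunE unlift_none.
  by apply/ffunP => y; rewrite !ffunE w_lift liftK.
rewrite -(on_card_preimset (f := phi)); last first.
  by exists psi => z _; [apply: phiK | apply: psiK].
apply: eq_card => f; rewrite !inE /=.
set h := finfun _; set x := f ord_max.
have stepw k y : iter k (step f) (w y) = w (iter k h y).
  by elim: k => //= k ->; rewrite ffunE.
(* From the first step on, iterates lie in the image of [w]. So n+1 is not periodic, and its orbit
   is itself together with the [h]-orbit of [x]. *)
have stepS k z : iter k.+1 (step f) z = w (iter k h (f z)).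
  by rewrite iterSr stepw.
congr (_ && _); last first.
  rewrite (_ : periodic_pts f = w @: periodic h) ?card_imset //.
  apply/setP => z; rewrite inE; apply/boolp.asboolP/imsetP => [[[|k] [// _ kz]] | [y /periodicP[k ky] ->]].
    rewrite stepS in kz; exists (iter k h (f z)) => //.
    apply/periodicP; exists k; apply: w_inj.
    by rewrite -[LHS]stepw kz stepS.
  by exists k.+1; rewrite stepw ky.
rewrite (_ : orbit_top f = ord_max |: w @: [set y | fconnect h x y]).
  rewrite cardsU1 card_imset // cardsE (_ : ord_max \notin _) //.
  by apply/imsetP => -[y _ /eqP]; rewrite (negPf (w_max y)).
apply/setP => z; rewrite !inE; apply/boolp.asboolP/orP.
  case=> [[|k] <-]; first by left.
  by right; rewrite stepS imset_f // inE fconnect_iter.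
case=> [/eqP-> | /imsetP[y]]; first by exists 0.
rewrite inE => /iter_findex <- ->; exists (findex h x y).+1.
by rewrite stepS.
Qed.

Local Open Scope ring_scope.

Theorem theorem4 (n i j : nat) : (1 <= n)%N ->
  (#|Fset n i.+1 j|)%:R =
  \sum_(0 <= s < minn i j)
     ((i + j - s - 1)%N)%:R * (n`!)%:R
       * invfact ((n%:Z - i%:Z - j%:Z + s%:Z + 1))
       * (n%:R : rat) ^ (n%:Z - i%:Z - j%:Z + s%:Z).
Proof.
move=> n_gt0.
have n_neq0 : n%:R != 0 :> rat by rewrite pnatr_eq0 -lt0n.
apply: (mulIf n_neq0); rewrite -natrM card_Fset.
have := card_pointed_maps 'I_n i j; rewrite card_ord => ->.
pose F s : rat := (i + j - s - 1)%N%:R * n`!%:R * invfact (n%:Z - i%:Z - j%:Z + s%:Z + 1)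
  * n%:R ^ (n%:Z - i%:Z - j%:Z + s%:Z) * n%:R.
rewrite natr_sum big_distrl /= big_mkord (big_ord_widen i F) ?geq_minl //.
(* With [k = i - 1 - s], the condition [i <= j + k] becomes [s < j]. *)
rewrite (reindex_inj rev_ord_inj) /=; apply: eq_big => s; have lt_s := ltn_ord s.
  by rewrite leq_min lt_s /=; apply/idP/idP; lia.
rewrite /F => le_i; set q := (j + _)%N.
have -> : (i + j - s - 1)%N = q by lia.
(* For [q > n] the falling factorial is 0, matching the convention for 1/m! at negative m. *)
case: (leqP q n) => [le_q | lt_q]; last first.
  rewrite ffact_small // !mul0n /invfact ifT; last by lia.
  by rewrite mulr0 !mul0r.
have -> : n%:Z - i%:Z - j%:Z + s%:Z = (n - q)%:Z - 1 by lia.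
have fact_neq0 : ((n - q)`!)%:R != 0 :> rat by rewrite pnatr_eq0 -lt0n fact_gt0.
rewrite subrK /invfact /= expfzDr // -exprnP exprN1 -(ffact_fact le_q).
rewrite !natrM natrX; field; exact/andP.
Qed.
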